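(* Let $G$ be a finite group. If $csd^*(G)>\frac{41}{49}$, then $G$ is an Iwasawa group. Moreover, $csd^*(G)=\frac{41}{49}$ if and only if $G\cong G'\times G''$ for some finite groups $G'$ and $G''$ such that $G'$ is a $2$-group with $csd^*(G')=\frac{41}{49}$ and $G''$ is an Iwasawa group of odd order.
   Context: For a finite group $G$, $L_1(G)$ denotes the set of all cyclic subgroups of $G$ (including the trivial subgroup), and the cyclic subgroup commutativity degree of $G$ is $$csd(G)=\frac{1}{|L_1(G)|^2}\left|\{(H,K)\in L_1(G)^2\mid HK=KH\}\right|,$$ where $HK=\{hk\mid h\in H,\,k\in K\}$ and the equality is an equality of sets. A section of $G$ is a quotient $A/B$ with $A\leq G$ and $B\trianglelefteq A$, and $csd^*(G)=\min\{csd(S)\mid S \text{ a section of } G\}$. A finite group is an Iwasawa group if it is nilpotent and modular (its subgroup lattice is a modular lattice); equivalently, all of its subgroups permute pairwise, i.e. $HK=KH$ for all subgroups $H,K$. Here $G'$ and $G''$ are just names of groups (not derived subgroups). *)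

(* Defs.v *)
From mathcomp Require Import all_boot all_order all_algebra all_fingroup.
From mathcomp Require Import all_solvable.

Set Implicit Arguments.
Unset Strict Implicit.
Unset Printing Implicit Defensive.

Import Order.TTheory GRing.Theory Num.Theory.

Local Open Scope group_scope.

Definition cyclic_subgroups (gT : finGroupType) (G : {set gT}) :
    {set {group gT}} :=
  [set H : {group gT} | (H \subset G) && cyclic H].

(* H * K is the setwise product, so the equality is an equality of subsets. *)
Definition commuting_cyclic_pairs (gT : finGroupType) (G : {set gT}) :
    {set {group gT} * {group gT}} :=
  [set HK : {group gT} * {group gT} |
    [&& HK.1 \in cyclic_subgroups G, HK.2 \in cyclic_subgroups G
      & HK.1 * HK.2 == HK.2 * HK.1 :> {set gT}]].

Definition csd (gT : finGroupType) (G : {set gT}) : rat :=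
  (#|commuting_cyclic_pairs G|%:R / #|cyclic_subgroups G|%:R ^+ 2)%R.

(* The library type [section gT] contains arbitrary pairs of groups; this     *)
(* predicate selects the pairs (A, B) for which A / B is a genuine section.   *)
Definition is_section_of (gT : finGroupType) (G : {group gT})
    (S : section gT) : bool :=
  (S.1 \subset G) && (S.2 <| S.1).

(* The seed (G / 1)%sec is itself a section of G; see csd_starP.              *)
Definition csd_star (gT : finGroupType) (G : {group gT}) : rat :=
  csd [arg min_(S < (G / 1)%sec | is_section_of G S) csd S]%O.

Definition modular_subgroup_lattice (gT : finGroupType) (G : {group gT}) :
    Prop :=
  forall H K L : {group gT},
    H \subset G -> K \subset G -> L \subset G -> H \subset L ->
    (H <*> K) :&: L = H <*> (K :&: L).

Definition Iwasawa (gT : finGroupType) (G : {group gT}) : Prop :=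
  nilpotent G /\ modular_subgroup_lattice G.

Lemma csd_starP (gT : finGroupType) (G : {group gT}) :
  (exists2 S, is_section_of G S & csd_star G = csd S) /\
  (forall S, is_section_of G S -> (csd_star G <= csd S)%R).
Proof.
rewrite /csd_star; case: arg_minP => [|S secS minS].
  by rewrite /is_section_of /= subxx normal1.
by split; [exists S | exact: minS].
Qed.

(* Main.v *)
Require Import Defs.
From mathcomp Require Import all_boot all_order all_algebra all_fingroup.
From mathcomp Require Import all_solvable.
From mathcomp Require Import zify.

(* Every section S of G satisfies csd* G <= csd S, so it suffices to find bad
   sections.  A group which is minimal non-nilpotent among its sections is a
   semidirect product V ><| Q with Q of prime order q and trivial centre (its
   non-simplicity is Schmidt's counting argument); all of its cyclic subgroups
   lie in V or are Sylow q-subgroups, no two of which permute, and this forces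
   csd < 41/49.  In a nilpotent group a minimal pair of non-permuting subgroups
   consists of two cyclic p-groups <x>, <y>, and <x^p><y^p> is normal in
   <x, y> with non-abelian quotient; this yields a non-abelian section of order
   p^3 generated by elements of order p, where csd <= 41/49 with strict
   inequality for odd p (equality occurs for the dihedral group of order 8).
   Conversely the factor of a coprime direct product all of whose subgroups
   permute does not affect csd. *)

Set Implicit Arguments.
Unset Strict Implicit.
Unset Printing Implicit Defensive.

Import Order.TTheory GRing.Theory Num.Theory.

Local Open Scope group_scope.

(** * Invariance and estimates of csd *)

Lemma ltr_nat_div (R : numFieldType) (a b c d : nat) : 0 < b -> 0 < d ->
  (a%:R / b%:R < c%:R / d%:R :> R)%R = (a * d < c * b)%N.
Proof.
move=> b_gt0 d_gt0; rewrite ltr_pdivrMr ?ltr0n // mulrAC ltr_pdivlMr ?ltr0n //.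
by rewrite -!natrM ltr_nat.
Qed.

Section CsdBasics.

Variable gT : finGroupType.
Implicit Types (G H K A B : {group gT}) (bad : {set {group gT} * {group gT}}).

Lemma mem_cyclic_subgroups G H :
  (H \in cyclic_subgroups G) = (H \subset G) && cyclic H.
Proof. by rewrite inE. Qed.

Lemma cycle_cyclic_subgroup G x : x \in G -> <[x]>%G \in cyclic_subgroups G.
Proof. by move=> Gx; rewrite mem_cyclic_subgroups /= cycle_subG Gx cycle_cyclic. Qed.

Lemma cyclic_subgroups_gt0 G : 0 < #|cyclic_subgroups G|.
Proof.
by apply/card_gt0P; exists 1%G; rewrite mem_cyclic_subgroups sub1G cyclic1.
Qed.

Definition noncommuting_cyclic_pairs (G : {set gT}) :=
  [set P : {group gT} * {group gT} |
    [&& P.1 \in cyclic_subgroups G, P.2 \in cyclic_subgroups G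
      & P.1 * P.2 != P.2 * P.1 :> {set gT}]].

Lemma card_noncommuting G :
  (#|commuting_cyclic_pairs G| + #|noncommuting_cyclic_pairs G|
    = #|cyclic_subgroups G| ^ 2)%N.
Proof.
rewrite -mulnn -cardsX.
rewrite -[RHS](cardsID [set P : {group gT} * {group gT} | P.1 * P.2 == P.2 * P.1 :> {set gT}]).
congr (_ + _)%N; apply: eq_card => -[H K].
  by rewrite in_setI in_setX !in_set /= andbA.
by rewrite in_setD in_setX !in_set /= andbA andbC.
Qed.

(** Since [1 - 41/49 = 8/49], later counts only have to bound the cyclic subgroups from above and
    the non-permuting pairs from below. *)
Lemma csd_lt_bound G :
  (8 * #|cyclic_subgroups G| ^ 2 < 49 * #|noncommuting_cyclic_pairs G|)%N ->
  (csd G < 41%:R / 49%:R)%R.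
Proof.
move=> lt_bad; rewrite /csd -natrX ltr_nat_div ?expn_gt0 ?cyclic_subgroups_gt0 //.
by have := card_noncommuting G; lia.
Qed.

Lemma csd_le_bound G :
  (8 * #|cyclic_subgroups G| ^ 2 <= 49 * #|noncommuting_cyclic_pairs G|)%N ->
  (csd G <= 41%:R / 49%:R)%R.
Proof.
move=> lt_bad; rewrite /csd -natrX leNgt ltr_nat_div ?expn_gt0 ?cyclic_subgroups_gt0 //.
by have := card_noncommuting G; lia.
Qed.

Lemma csd_star_le G A B :
  A \subset G -> B <| A -> (csd_star G <= csd (A / B)%g)%R.
Proof.
move=> sAG nsBA; have [_ /(_ (GSection (A, B)))] := csd_starP G.
by apply; rewrite /is_section_of sAG.
Qed.

Lemma csd_star_ex G :
  exists A B : {group gT}, [/\ A \subset G, B <| A & csd_star G = csd (A / B)].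
Proof.
have [[[[A B]]] /andP[/= sAG nsBA] def_csd _] := csd_starP G.
by exists A, B.
Qed.

Lemma csd_starS G H : H \subset G -> (csd_star G <= csd_star H)%R.
Proof.
move=> sHG; have [A [B [sAH nsBA ->]]] := csd_star_ex H.
by apply: csd_star_le; rewrite ?(subset_trans sAH).
Qed.

End CsdBasics.

Section CsdMorphism.

Variables aT rT : finGroupType.

Lemma isog_csd (G : {group aT}) (H : {group rT}) :
  G \isog H -> csd G = csd H.
Proof.
case/isogP=> f injf <-{H}.
pose F (X : {group aT}) := (f @* X)%G.
have injF: {in cyclic_subgroups G &, injective F}.
  move=> X Y; rewrite !mem_cyclic_subgroups => /andP[sXG _] /andP[sYG _].
  by case/(congr1 val)=> /(injm_morphim_inj injf sXG sYG)/val_inj.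
have defC: cyclic_subgroups (f @* G) = F @: cyclic_subgroups G.
  apply/setP=> Y; apply/idP/imsetP=> [|[X]]; last first.
    rewrite !mem_cyclic_subgroups => /andP[sXG cycX] ->.
    by rewrite /= morphimS ?morphim_cyclic.
  rewrite mem_cyclic_subgroups => /andP[sYG cycY].
  exists (f @*^-1 Y)%G; last by apply/val_inj; rewrite /= morphpreK.
  rewrite mem_cyclic_subgroups subsetIl /=.
  by rewrite -(injm_cyclic injf) ?subsetIl ?morphpreK.
have defP: commuting_cyclic_pairs (f @* G)
   = (fun P => (F P.1, F P.2)) @: commuting_cyclic_pairs G.
  apply/setP=> -[X Y]; rewrite inE /= defC; apply/and3P/imsetP.
    case=> /imsetP[X1 X1G ->] /imsetP[Y1 Y1G ->] /eqP cXY.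
    exists (X1, Y1) => //; rewrite inE /= X1G Y1G /=; apply/eqP.
    move: X1G Y1G cXY; rewrite !mem_cyclic_subgroups /=.
    case/andP=> sXG _ /andP[sYG _]; rewrite -!morphimMl //.
    by apply: (injm_morphim_inj injf); rewrite mul_subG.
  case=> -[X1 Y1]; rewrite inE /= => /and3P[X1G Y1G /eqP cXY] [-> ->].
  split; rewrite ?imset_f //=; move: X1G Y1G; rewrite !mem_cyclic_subgroups /=.
  by case/andP=> sXG _ /andP[sYG _]; rewrite -!morphimMl // cXY.
rewrite /csd defC defP !card_in_imset // => -[X Y] [X1 Y1].
rewrite inE => /and3P[/= GX GY _]; rewrite inE => /and3P[/= GX1 GY1 _].
move=> eqF; congr (_, _); apply: injF => //; move: eqF.
  by move/(congr1 fst).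
by move/(congr1 snd).
Qed.

End CsdMorphism.

(** A section [A / B] of the image is itself the image of [C], the preimage of [A] in [G], under [f]
    followed by the coset map. The first isomorphism theorem makes it isomorphic to a section of
    [G]. *)
Lemma csd_star_morphim (aT rT : finGroupType) (D : {group aT})
    (f : {morphism D >-> rT}) (G : {group aT}) :
  G \subset D -> (csd_star G <= csd_star (f @* G)%G)%R.
Proof.
move=> sGD; have [A [B [sAG /andP[_ nBA] ->]]] := csd_star_ex (f @* G)%G.
pose C := (G :&: f @*^-1 A)%G.
have fC: f @* C = A by rewrite morphim_setIpre; apply/setIidPr.
pose g := coset_morphism B.
have sCd: C \subset 'dom (g \o f).
  rewrite -sub_morphim_pre ?fC //.
  by apply: subset_trans (subsetIl _ _) sGD.
have -> : (A / B)%g = (g \o f) @* C by rewrite morphim_comp fC.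
pose E := (f @*^-1 'N(B))%G; pose gf : {morphism E >-> _} := [morphism of g \o f].
have sCE: C \subset E by [].
have isoC: C / 'ker_C gf \isog (g \o f) @* C := first_isog_loc gf sCE.
rewrite -(isog_csd isoC).
exact: csd_star_le (subsetIl _ _) (normalGI sCE (ker_normal gf)).
Qed.

Lemma csd_star_quotient (gT : finGroupType) (G N : {group gT}) :
  G \subset 'N(N) -> (csd_star G <= csd_star (G / N)%G)%R.
Proof. exact: csd_star_morphim. Qed.

Lemma isog_csd_star (aT rT : finGroupType) (G : {group aT}) (H : {group rT}) :
  G \isog H -> csd_star G = csd_star H.
Proof.
have le_isog (T1 T2 : finGroupType) (K : {group T1}) (L : {group T2}) :
    K \isog L -> (csd_star K <= csd_star L)%R.
  case/isogP=> f _ fK; have -> : L = (f @* K)%G by apply/val_inj.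
  exact: csd_star_morphim.
by move=> isoGH; apply/eqP; rewrite eq_le !le_isog // isog_sym.
Qed.

Lemma csd_star_le_csd (gT : finGroupType) (G : {group gT}) :
  (csd_star G <= csd G)%R.
Proof.
rewrite (isog_csd (quotient1_isog G)).
exact: csd_star_le (subxx _) (normal1 _).
Qed.

(** * Non-nilpotent groups *)

Section MinimalNonnilpotent.

Variables (gT : finGroupType) (G : {group gT}).
Implicit Types (H K M N V Q : {group gT}).

Hypothesis nilS : forall H, H \proper G -> nilpotent H.
Hypothesis not_nilG : ~~ nilpotent G.

(** Induction from larger intersections to smaller ones. If the intersection [I] is non-trivial, its
    normaliser in [G] is proper and lies in a maximal [M3]. Normalisers grow in the nilpotent groups
    [M1] and [M2], so each of them meets [M3] in more than [I] and equals [M3] by induction. *)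
Lemma simple_maximal_TI M1 M2 :
    (forall N, N <| G -> N :=: 1 \/ N :=: G) ->
  maximal M1 G -> maximal M2 G -> M1 != M2 -> M1 :&: M2 = 1.
Proof.
move=> simG; have [n] := ubnP (#|G| - #|M1 :&: M2|).
elim: n M1 M2 => // n IHn M1 M2 /ltnSE-le_n maxM1 maxM2 neM12.
have [//|ntI] := eqVneq (M1 :&: M2) 1; pose I := (M1 :&: M2)%G.
have proper_I M : M \in [:: M1; M2] -> maximal M G /\ I \proper M.
  have maxE (L1 L2 : {group gT}) : maximal L1 G -> maximal L2 G -> L1 \subset L2 -> L1 = L2.
    move=> /maxgroupP[_ maxL1] /maxgroupp prL2 sL12.
    by apply/val_inj; rewrite /= (maxL1 _ prL2).
  rewrite !inE => /orP[]/eqP-> ; split=> //; rewrite properE ?subsetIl ?subsetIr /=;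
    rewrite subsetI ?subxx ?andbT /=; apply: contra neM12 => /maxE-> //.
have sIG : I \subset G.
  by have [/maxgroupp/proper_sub sMG _] := proper_I M1 (mem_head _ _); rewrite subIset ?sMG.
have prN : 'N_G(I) \proper G.
  rewrite properE subsetIl subsetI subxx /=; apply/negP=> nIG.
  have [|I1|IG] := simG I; first by rewrite /normal sIG.
    by rewrite I1 eqxx in ntI.
  have [/maxgroupp prM /proper_sub sIM] := proper_I M1 (mem_head _ _).
  by move: prM; rewrite properE -IG sIM andbF.
have [eNG | [M3 maxM3 sNM3]] := maximal_exists (proper_sub prN).
  by case/eqP: (proper_neq prN).
have eqM3 M : M \in [:: M1; M2] -> M = M3.
  case/proper_I=> maxM prI; apply/eqP/negPn/negP=> neM.
  have prMG := maxgroupp maxM.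
  have: I \proper M :&: M3.
    apply: proper_sub_trans (nilpotent_proper_norm (nilS prMG) prI) _.
    rewrite subsetI subsetIl (subset_trans _ sNM3) //.
    by rewrite setSI ?proper_sub.
  move=> prI3; have ltI := proper_card prI3.
  have leMG : #|M :&: M3| <= #|G|.
    by rewrite subset_leq_card // subIset ?(proper_sub prMG).
  have M31: M :&: M3 = 1.
    apply: IHn => //; apply: leq_trans le_n.
    by rewrite ltn_sub2l ?(leq_trans ltI).
  have ltI1 : #|M :&: M3| = 1%N by rewrite M31 cards1.
  by move: ltI; rewrite ltI1 ltnNge cardG_gt0.
have eqM1 : M1 = M3 by apply: eqM3; rewrite mem_head.
have eqM2 : M2 = M3 by apply: eqM3; rewrite inE mem_head orbT.
by rewrite eqM1 eqM2 eqxx in neM12.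
Qed.

(** Otherwise maximal subgroups are self-normalising with trivial pairwise intersections, so the
    conjugates of one of them, [M], cover [|G| - |G : M|] non-identity elements, at least half of
    [|G|]. Two conjugacy classes would then cover more than [|G| - 1] elements. *)
Lemma min_nonnilpotent_not_simple : ~ (forall N, N <| G -> N :=: 1 \/ N :=: G).
Proof.
move=> simG; have TI := simple_maximal_TI simG.
have cycG x : x \in G -> exists2 M : {group gT}, maximal M G & x \in M.
  rewrite -cycle_subG => /maximal_exists[eqG | [M maxM sxM]].
    by case/negP: not_nilG; rewrite -eqG abelian_nil ?cycle_abelian.
  by exists M; rewrite // -cycle_subG.
have [x0 Gx0 ntx0] : exists2 x, x \in G & x != 1.
  by apply/trivgPn; apply: contraNneq not_nilG => ->; apply: nilpotent1.
have prM M : maximal M G -> M \proper G by apply: maxgroupp.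
have sMG M : maximal M G -> M \subset G by move/prM/proper_sub.
have ntM M : maximal M G -> M :!=: 1.
  move=> maxM; apply/eqP=> M1; have [M' maxM' M'x] := cycG _ Gx0.
  have /maxgroupP[_ /(_ M' (prM _ maxM'))] := maxM.
  by rewrite {1}M1 sub1G M1 => /(_ isT) M'1; rewrite M'1 inE (negPf ntx0) in M'x.
have conjM M x : maximal M G -> x \in G -> maximal (M :^ x)%G G.
  by move=> maxM Gx; rewrite -(conjGid Gx) maximalJ.
have nMG M : maximal M G -> 'N_G(M) = M.
  move=> maxM; have /maxgroupP[_ mxM] := maxM.
  have [prN|] := boolP ('N_G(M) \proper G).
    by apply: mxM; rewrite // subsetI sMG ?normG.
  rewrite properE subsetIl negbK subsetI subxx /= => nMG.
  have [|M1|MG] := simG M; first by rewrite /normal sMG.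
    by case/eqP: (ntM M maxM).
  by have := prM M maxM; rewrite MG properxx.
have tiM M : maximal M G -> normedTI M^# G M.
  move=> maxM; apply/normedTI_P; split.
  - by rewrite setD_eq0 subG1 ntM.
  - by rewrite subsetI sMG ?normD1 ?normG.
  move=> g Gg; apply: contraR => notMg.
  rewrite -setI_eq0 conjD1g -setDIl setD_eq0.
  have -> // : M :&: M :^ g = 1.
  apply: (TI M (M :^ g)%G); rewrite ?conjM //; apply: contra notMg => /eqP eqMg.
  by rewrite -(nMG M) // inE Gg; apply/normP; rewrite [in RHS]eqMg.
pose S M := class_support M^# G.
have sSG M : maximal M G -> S M \subset G^#.
  move=> maxM; rewrite subsetD1 class_support_subG ?subDset ?subsetU ?sMG ?orbT //=.
  by apply/imset2P=> -[x y /setD1P[ntx _] _ /esym/eqP]; rewrite conjg_eq1 (negPf ntx).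
have cardS M : maximal M G -> (#|S M| + #|G : M| = #|G|)%N /\ 2 * #|G : M| <= #|G|.
  move=> maxM; rewrite /S (card_support_normedTI (tiM M maxM)).
  rewrite mulnC -(Lagrange (sMG M maxM)) (cardsD1 1 M) group1.
  split; first by rewrite mulnDl mul1n addnC mulnC.
  by apply: leq_mul => //; rewrite ltnS card_gt0 setD_eq0 subG1 ntM.
have cardG1 : #|G| = #|G^#|.+1 by rewrite (cardsD1 1 G) group1.
have [M1 maxM1 _] := cycG _ Gx0.
(* One class leaves out [|G : M1| - 1 > 0] non-identity elements; a maximal subgroup [M2] through
   such an [x] belongs to another class. *)
have [x /andP[Gx notS1x]]: exists x, (x \in G^#) && (x \notin S M1).
  apply/existsP; apply: contraT => /existsPn noS; exfalso.
  have: G^# \subset S M1.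
    by apply/subsetP=> x Gx; have := noS x; rewrite Gx negbK.
  move/subset_leq_card; have [eqS _] := cardS _ maxM1.
  have: 1 < #|G : M1| by rewrite indexg_gt1 proper_subn ?prM.
  by move: eqS cardG1; move: #|_| #|_| #|_| #|_ : _| => s g d i; lia.
have /setD1P[ntx {}Gx] := Gx.
have [M2 maxM2 M2x] := cycG x Gx.
(* A common element would lie in a conjugate of [M1] and one of [M2], forcing these to coincide;
   then [x] is conjugate into [M1], against its choice. *)
have disS : S M1 :&: S M2 = set0.
  apply/setP=> y; rewrite !inE; apply/negP=> /andP[].
  case/imset2P=> [u g /setD1P[ntu M1u] Gg ->{y}].
  case/imset2P=> [v h /setD1P[ntv M2v] Gh eq_uv].
  have [eqM|neM] := eqVneq (M1 :^ g)%G (M2 :^ h)%G; last first.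
    have := TI _ _ (conjM _ _ maxM1 Gg) (conjM _ _ maxM2 Gh) neM.
    move/setP/(_ (u ^ g)); rewrite !inE {2}eq_uv !memJ_conjg M1u M2v.
    by rewrite conjg_eq1 (negPf ntu).
  case/imset2P: notS1x; exists (x ^ (h * g^-1)) (g * h^-1).
  - rewrite !inE conjg_eq1 ntx conjgM -mem_conjg.
    by have /(congr1 val)/= -> := eqM; rewrite memJ_conjg.
  - by rewrite groupM ?groupV.
  by rewrite -conjgM mulgA mulgKV mulgV conjg1.
have := subset_leq_card (_ : S M1 :|: S M2 \subset G^#).
rewrite subUset !sSG // => /(_ isT); rewrite cardsU disS cards0.
have [] := cardS _ maxM1; have [] := cardS _ maxM2; move: cardG1.
by move: #|_| #|_| #|_| #|_| #|_ : _| #|_ : _|; lia.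
Qed.

End MinimalNonnilpotent.

Lemma normal_Sylows_nilpotent (gT : finGroupType) (G : {group gT}) :
  (forall p (P : {group gT}), p.-Sylow(G) P -> P <| G) -> nilpotent G.
Proof.
move=> nsP; suff: G \subset 'F(G) by move/nilpotentS; apply; apply: Fitting_nil.
rewrite -{1}(Sylow_gen G) gen_subG; apply/bigcupsP=> P /SylowP[p _ sylP].
apply: Fitting_max; first exact: nsP sylP.
exact: pgroup_nil (pHall_pgroup sylP).
Qed.

(** [V] is a minimal normal subgroup and [Q] a non-normal Sylow [q]-subgroup. Nilpotency of proper
    subgroups and quotients forces [G = V * Q], and triviality of the centre cuts [Q] down to order
    [q]. *)
Lemma minimal_nonnilpotent_structure (gT : finGroupType) (G : {group gT}) :
    (forall H : {group gT}, H \proper G -> nilpotent H) ->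
    (forall N : {group gT}, N <| G -> N :!=: 1 -> nilpotent (G / N)) ->
    ~~ nilpotent G ->
  exists q (V : {group gT}),
    [/\ prime q, V <| G /\ V :!=: 1, q^'.-group V, #|G| = (#|V| * q)%N
      & forall Q : {group gT}, q.-Sylow(G) Q -> 'C_V(Q) = 1].
Proof.
move=> nilS nilQ not_nilG.
have Z1 : 'Z(G) = 1.
  apply/eqP; apply: contraR not_nilG => ntZ.
  by rewrite -quotient_center_nil; apply: nilQ; rewrite ?center_normal.
have ntG : G :!=: 1 by apply: contraNneq not_nilG => ->; apply: nilpotent1.
have [V minV sVG] := minnormal_exists ntG (normG G).
have /mingroupP[/andP[ntV nVG] minV'] := minV.
have nsVG : V <| G by rewrite /normal sVG.
(* If [V] were all of [G], its minimality would make [G] simple. *)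
have prV : V \proper G.
  rewrite properEneq sVG andbT; apply/eqP=> eqVG.
  case: (min_nonnilpotent_not_simple nilS not_nilG) => N /andP[sNG nNG].
  have [|ntN] := eqVneq (N : {set gT}) 1; first by left.
  by right; rewrite -[RHS]eqVG; apply: minV'; rewrite ?ntN ?eqVG.
have nilV := nilS _ prV.
have [_ _ /is_abelemP[p _ abelV]] :=
  minnormal_solvable minV (subxx V) (nilpotent_sol nilV).
have /and3P[pV cVV _] := abelV.
have [q [Q sylQ nnQ]] : exists q, exists2 Q : {group gT}, q.-Sylow(G) Q & ~~ (Q <| G).
  case: (pickP [pred P : {group gT} | Sylow G P && ~~ (P <| G)]) => [P | noP].
    by case/andP=> /SylowP[q _ sylP] nnP; exists q, P.
  case/negP: not_nilG; apply: normal_Sylows_nilpotent => q P sylP.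
  by have := noP P; rewrite /= (p_Sylow sylP) /= => /negbFE.
have [sQG qQ _] := and3P sylQ.
have nVQ := subset_trans sQG nVG.
(* Modulo [V] the Sylow subgroup is the [q]-core of a nilpotent group. *)
have nsQVG : Q <*> V <| G.
  have nilGV : nilpotent (G / V) by apply: nilQ.
  have sylQV : q.-Sylow(G / V) (Q / V) by apply: quotient_pHall.
  have := pcore_normal q (G / V); rewrite -(nilpotent_Hall_pcore nilGV sylQV).
  rewrite /= -(quotientYidr nVQ) => nsQV.
  rewrite -(quotientGK nsVG) -(quotientGK (_ : V <| Q <*> V)) ?cosetpre_normal //.
  by rewrite /normal joing_subr join_subG nVQ normG.
(* Otherwise [Q] would be characteristic in the nilpotent normal subgroup [Q <*> V], hence normal in
   [G]. *)
have defG : Q <*> V = G.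
  apply/eqP; rewrite eqEproper normal_sub //; apply: contra nnQ => prQV.
  have nilQV := nilS (Q <*> V)%G prQV.
  have sylQ' : q.-Sylow(Q <*> V) Q := pHall_subl (joing_subl _ _) (normal_sub nsQVG) sylQ.
  by rewrite (nilpotent_Hall_pcore nilQV sylQ') (char_normal_trans (pcore_char _ _)).
have neq_qp : q != p.
  apply: contraNneq nnQ => eqp; rewrite eqp in sylQ qQ.
  have -> : Q :=: G; last exact: normal_refl.
  apply: pHall_id sylQ _; rewrite -defG norm_joinEl //.
  by rewrite pgroupM qQ.
have q'V : q^'.-group V by apply: pi_pnat pV _; rewrite !inE eq_sym.
have coVQ : coprime #|V| #|Q| by rewrite coprime_sym (pnat_coprime qQ).
have tiVQ : V :&: Q = 1 := coprime_TIg coVQ.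
have defGm : V * Q = G by rewrite -defG joingC norm_joinEr.
have oG : #|G| = (#|V| * #|Q|)%N by rewrite -defGm TI_cardMg.
(* [V] and a proper [Y] generate a proper, hence nilpotent, subgroup, in which subgroups of coprime
   orders centralise each other. *)
have cVY (Y : {group gT}) : Y \proper Q -> Y \subset 'C(V).
  move=> prY; have sYQ := proper_sub prY; have nVY := subset_trans sYQ nVQ.
  have coVY : coprime #|V| #|Y| := coprimegS sYQ coVQ.
  have /nilS nilVY : (V <*> Y)%G \proper G.
    rewrite properEcard join_subG sVG (subset_trans sYQ) //=.
    rewrite norm_joinEr // coprime_cardMg // oG ltn_pmul2l ?cardG_gt0 //.
    exact: proper_card.
  by apply: (sub_nilpotent_cent2 nilVY); rewrite ?joing_subl ?joing_subr // coprime_sym.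
have [x Qx ncxV] : exists2 x, x \in Q & x \notin 'C(V).
  apply/subsetPn; apply: contra nnQ => cVQ.
  by rewrite /normal sQG -defGm mul_subG ?normG ?cents_norm // centsC.
have defQ : <[x]> = Q.
  apply/eqP; rewrite eqEproper cycle_subG Qx; apply: contra ncxV => /(cVY <[x]>%G).
  by rewrite cycle_subG.
have [q_pr q_dv _] : [/\ prime q, q %| #[x] & True].
  have [|q_pr q_dv _] := pgroup_pdiv qQ; last by rewrite /order defQ.
  by apply: contraNneq ncxV => Q1; rewrite Q1 inE in Qx; rewrite (eqP Qx) group1.
have CV_Q (R : {group gT}) : q.-Sylow(G) R -> 'C_V(R) = 1.
  move=> sylR; apply/trivgP; rewrite -Z1 subsetI subIset ?sVG //=.
  suff <- : V * R = G by rewrite centM setSI.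
  apply/eqP; rewrite eqEcard mul_subG ?(pHall_sub sylR) //= coprime_cardMg.
    by rewrite oG (card_Hall sylR) (card_Hall sylQ).
  by rewrite coprime_sym (pnat_coprime (pHall_pgroup sylR)).
(* [x ^+ q] generates a proper subgroup of [Q], so it centralises [V]; it also centralises [Q =
   <[x]>], so it is central in [G]. *)
have xq1 : x ^+ q = 1.
  apply/set1gP; rewrite -Z1 inE groupX ?(subsetP sQG) //=.
  rewrite -defGm centM inE; apply/andP; split.
    rewrite -cycle_subG cVY // -defQ properEcard cycle_subG mem_cycle.
    by rewrite -!orderE orderXdiv // ltn_Pdiv ?prime_gt1.
  by rewrite -defQ cent_cycle groupX ?cent1id.
exists q, V; split=> //; rewrite oG -defQ -orderE.
have -> // : #[x] = q.
apply/prime_nt_dvdP; rewrite ?order_dvdn ?xq1 // order_eq1.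
by apply: contraNneq ncxV => ->; apply: group1.
Qed.

(** There are [|V|] Sylow [q]-subgroups and at most [2 |V|] cyclic subgroups. Distinct Sylow
    subgroups never permute, since their product would be a [q]-group larger than either. *)
Lemma csd_lt_min_nonnilpotent (gT : finGroupType) (G V : {group gT}) q :
    prime q -> V <| G -> V :!=: 1 -> q^'.-group V -> #|G| = (#|V| * q)%N ->
    (forall Q : {group gT}, q.-Sylow(G) Q -> 'C_V(Q) = 1) ->
  (csd G < 41%:R / 49%:R)%R.
Proof.
move=> q_pr /andP[sVG nVG] ntV q'V oG CV1; pose S := 'Syl_q(G).
have SP (Q : {group gT}) : reflect (q.-Sylow(G) Q) (Q \in S) by rewrite inE; apply: idP.
have oq : (#|G|`_q)%N = q.
  by rewrite oG partnM // ?prime_gt0 // part_p'nat // part_pnat_id ?mul1n ?pnat_id.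
(* [[N_V(Q), Q]] lies in both [V] and [Q], so [N_V(Q)] centralises [Q] and is trivial. Hence [Q] is
   self-normalising and has [|G : Q| = |V|] conjugates. *)
have oS : #|S| = #|V|.
  have [Q sylQ] := Sylow_exists q G; have [sQG qQ _] := and3P sylQ.
  have oQ : #|Q| = q by rewrite (card_Hall sylQ) oq.
  have coVQ : coprime #|V| #|Q| by rewrite coprime_sym (pnat_coprime qQ).
  have defG : V * Q = G.
    by apply/eqP; rewrite eqEcard mul_subG // coprime_cardMg // oG oQ leqnn.
  have NV1 : 'N_V(Q) = 1.
    apply/trivgP; rewrite -(CV1 Q sylQ) subsetI subsetIl /=.
    apply/commG1P/trivgP; rewrite -(coprime_TIg coVQ) subsetI.
    rewrite (subset_trans (commSg _ (subsetIl _ _))) ?commg_subl ?(subset_trans sQG) //.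
    by rewrite (subset_trans (commSg _ (subsetIr _ _))) // commg_subr.
  have NG : 'N_G(Q) = Q.
    by rewrite -{1}defG setIC -group_modr ?normG // setIC NV1 mul1g.
  apply/eqP; rewrite (card_Syl sylQ) NG -(eqn_pmul2l (cardG_gt0 Q)) Lagrange // oG.
  by rewrite oQ mulnC.
have gt2V : 2 < #|V|.
  (* Sylow's congruence [|V| = 1] modulo [q] excludes [|V| = 2]. *)
  have := card_Syl_mod G q_pr; rewrite -/S oS; move: ntV; rewrite -cardG_gt1.
  have := prime_gt1 q_pr; case: #|V| => [|[|[|m]]] //.
  by case: (q) => [|[|[|r]]].
have hallV : q^'.-Hall(G) V.
  by rewrite /pHall sVG q'V -divgS // oG mulKn ?cardG_gt0 // pnatNK pnat_id.
have memV x : x \in G -> q^'.-elt x -> x \in V.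
  by move=> Gx; rewrite (mem_normal_Hall hallV) // /normal sVG.
(* If the [q]-part of a generator is non-trivial, it generates a Sylow subgroup, whose centraliser
   in [V] is trivial, so the other part vanishes. If it is trivial, the generator lies in [V]. *)
have cycS : cyclic_subgroups G \subset S :|: [set <[v]>%G | v in V].
  apply/subsetP=> H; rewrite mem_cyclic_subgroups inE => /andP[+ /cyclicP[x defH]].
  have -> : H = <[x]>%G by apply/val_inj.
  rewrite /= cycle_subG => Gx; have [xq1|ntxq] := eqVneq x.`_q 1.
    by apply/orP; right; apply/imset_f; rewrite memV //; apply/constt1P.
  have Gxq : x.`_q \in G by apply: groupX.
  have sylR : q.-Sylow(G) <[x.`_q]>.
    apply/pHallP; rewrite cycle_subG Gxq oq -orderE; split=> //.
    apply/prime_nt_dvdP; rewrite ?order_eq1 // order_constt.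
    by rewrite -[X in _ %| X]oq partn_dvd ?cardG_gt0 ?order_dvdG.
  have xq'1 : x.`_q^' = 1.
    apply/set1gP; rewrite -(CV1 _ sylR) inE cent_cycle memV ?p_elt_constt //=;
      last exact: groupX.
    by apply/cent1P; apply: commuteX2.
  have defx : x.`_q = x by rewrite -[RHS](consttC q) xq'1 mulg1.
  by rewrite defx in sylR; apply/orP; left; apply/SP.
have leS : #|cyclic_subgroups G| <= 2 * #|V|.
  apply: leq_trans (subset_leq_card cycS) _; rewrite mul2n -addnn -{1}oS.
  by apply: leq_trans (leq_card_setU _ _) _; rewrite leq_add2l leq_imset_card.
pose D := [set (Q, Q) | Q in S].
have sD : setX S S :\: D \subset noncommuting_cyclic_pairs G.
  apply/subsetP=> -[Q R]; rewrite in_setD in_setX => /and3P[notD SQ SR].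
  have [/SP sylQ /SP sylR] := (SQ, SR).
  have cyc (P : {group gT}) : q.-Sylow(G) P -> P \in cyclic_subgroups G.
    move=> sylP; rewrite mem_cyclic_subgroups (pHall_sub sylP) prime_cyclic //.
    by rewrite (card_Hall sylP) oq.
  rewrite inE /= !cyc //=; apply: contra notD => /eqP/comm_joingE cQR.
  have sQRG : Q <*> R \subset G by rewrite join_subG (pHall_sub sylQ) (pHall_sub sylR).
  have qQR : q.-group (Q <*> R).
    by rewrite cQR pgroupM (pHall_pgroup sylQ) (pHall_pgroup sylR).
  have -> : R = Q.
    apply/val_inj; rewrite /= -(sub_pHall sylR qQR) ?joing_subr //.
    by apply: (sub_pHall sylQ); rewrite ?joing_subl.
  exact: imset_f.
have cardD : #|D| = #|S| by rewrite card_imset // => Q R [].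
have sDS : D \subset setX S S.
  by apply/subsetP=> _ /imsetP[Q SQ ->]; rewrite in_setX SQ.
apply: csd_lt_bound; have := subset_leq_card sD.
rewrite cardsD (setIidPr sDS) cardsX cardD oS => le_bad.
(* With [v = |V|] this is [32 v^2 < 49 (v^2 - v)], true exactly from [v = 3] on. *)
apply: leq_ltn_trans (_ : 8 * (2 * #|V|) ^ 2 < _)%N; first by rewrite leq_mul2l leq_exp2r.
apply: leq_trans (_ : _ <= 49 * (#|V| * #|V| - #|V|))%N _; last by rewrite leq_mul2l.
move: #|V| gt2V => v; nia.
Qed.

Lemma csd_star_nonnilpotent (gT : finGroupType) (G : {group gT}) :
  ~~ nilpotent G -> (csd_star G < 41%:R / 49%:R)%R.
Proof.
(* The induction on the order ranges over all group types, because a quotient lives in a type of its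
   own. *)
suff bound n : forall (hT : finGroupType) (H : {group hT}), #|H| <= n ->
    ~~ nilpotent H -> (csd_star H < 41%:R / 49%:R)%R.
  exact: (bound _ _ _ (leqnn #|G|)).
elim: n => [|n IHn] {gT G} gT G.
  by move=> le0; case: (notF (leq_trans (cardG_gt0 G) le0)).
move=> leGn not_nilG.
case: (pickP [pred H : {group gT} | (H \proper G) && ~~ nilpotent H]) => [H|nilS].
  case/andP=> prHG not_nilH; apply: le_lt_trans (csd_starS (proper_sub prHG)) _.
  by apply: IHn => //; rewrite -ltnS (leq_trans (proper_card prHG)).
case: (pickP [pred N : {group gT} | [&& N <| G, N :!=: 1 & ~~ nilpotent (G / N)]])
    => [N|nilQ].
  case/and3P=> nsNG ntN not_nilGN.
  apply: le_lt_trans (csd_star_quotient (normal_norm nsNG)) _.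
  by apply: IHn => //; rewrite -ltnS (leq_trans (ltn_quotient _ _)) ?normal_sub.
have [||//|q [V [q_pr [nsV ntV] q'V oG CV]]] := @minimal_nonnilpotent_structure _ G.
- by move=> H prH; have := nilS H; rewrite /= prH => /negbFE.
- by move=> N nsN ntN; have := nilQ N; rewrite /= nsN ntN => /negbFE.
exact: le_lt_trans (csd_star_le_csd G) (csd_lt_min_nonnilpotent q_pr nsV ntV q'V oG CV).
Qed.

(** * Permuting subgroups of nilpotent groups *)

(** A boolean form of the Iwasawa property: for nilpotent groups it is equivalent to modularity, by
    [permutable_modular] and [modular_permutable]. *)
Definition permutable (gT : finGroupType) (G : {set gT}) :=
  [forall H : {group gT}, forall K : {group gT},
    (H \subset G) && (K \subset G) ==> (H * K == K * H :> {set gT})].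

Section Permutable.

Variable gT : finGroupType.
Implicit Types (G H K L X Y : {group gT}).

Lemma permutableP (A : {set gT}) :
  reflect (forall H K, H \subset A -> K \subset A -> commute H K)
          (permutable A).
Proof.
apply: (iffP forallP) => [perA H K sHA sKA | perA H].
  by have /forallP/(_ K) := perA H; rewrite sHA sKA => /eqP.
by apply/forallP=> K; apply/implyP=> /andP[sHA sKA]; apply/eqP/perA.
Qed.

Lemma permutableS G H : H \subset G -> permutable G -> permutable H.
Proof.
move=> sHG /permutableP perG; apply/permutableP=> K L sKH sLH.
by apply: perG; apply: subset_trans sHG.
Qed.

(** Joins of permuting subgroups are products, and Dedekind's law [group_modl] applies. *)
Lemma permutable_modular G : permutable G -> modular_subgroup_lattice G.
Proof.
move=> /permutableP perG H K L sHG sKG sLG sHL.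
have cHKL : commute H (K :&: L)%G by apply: perG; rewrite //= subIset ?sKG.
by rewrite (comm_joingE (perG H K sHG sKG)) (comm_joingE cHKL) group_modl.
Qed.

Lemma commute_cycles H K :
  (forall x, x \in H -> commute <[x]> K) -> commute H K.
Proof.
move=> cHK; apply/eqP; rewrite eqEsubset; apply/andP; split; apply/subsetP=> z.
  case/mulsgP=> x y Hx Ky ->; apply: (subsetP (mulgS K _)) (_ : x * y \in K * <[x]>).
    by rewrite cycle_subG.
  by rewrite -cHK // mem_mulg ?cycle_id.
case/mulsgP=> y x Ky Hx ->; apply: (subsetP (mulSg K _)) (_ : y * x \in <[x]> * K).
  by rewrite cycle_subG.
by rewrite cHK // mem_mulg ?cycle_id.
Qed.

Lemma commute_mulG (A B C : {set gT}) :
  commute A C -> commute B C -> commute (A * B) C.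
Proof. by rewrite /commute => cAC cBC; rewrite -mulgA cBC !mulgA cAC. Qed.

(** A non-cyclic [H] is the union of its proper cyclic subgroups, and a cyclic group not of prime
    power order is a product of two proper subgroups; in either case permutability with [K] would
    pass to [H]. *)
Lemma min_noncommuting H K :
    (forall L, L \proper H -> commute L K) -> ~ commute H K ->
  exists p x, [/\ prime p, H :=: <[x]>, p.-elt x & x != 1].
Proof.
move=> cLK ncHK.
have [x defH] : exists x, H :=: <[x]>.
  case: (pickP [pred x in H | H \subset <[x]>]) => [x /andP[Hx sHx] | noH].
    by exists x; apply/eqP; rewrite eqEsubset sHx cycle_subG.
  case: ncHK; apply: commute_cycles => x Hx; apply: (cLK <[x]>%G).
  by rewrite properE /= cycle_subG Hx; have /= := noH x; rewrite Hx => /= ->.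
have ntx : x != 1.
  apply: contra_notN ncHK => /eqP x1; rewrite defH x1 cycle1.
  by rewrite /commute mul1g mulg1.
have p_pr : prime (pdiv #[x]) by rewrite pdiv_prime // order_gt1.
exists (pdiv #[x]), x; split=> //; set p := pdiv _ in p_pr *.
have dvd_px : p %| #[x] by apply: pdiv_dvd.
have pr_constt (pi : nat_pred) : ~~ pi.-elt x -> commute <[x.`_pi]> K.
  move=> pi'x; apply: (cLK <[x.`_pi]>%G); rewrite defH properE /= cycle_subG cycle_constt /=.
  by apply: contra pi'x => sx; apply: pgroupS sx (p_elt_constt pi x).
apply/negPn/negP=> npx; case: ncHK; rewrite defH -(consttC p x) cycleM; last 2 first.
- by apply: commuteX2.
- exact: pnat_coprime (p_elt_constt p x) (p_elt_constt _ _).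
apply: commute_mulG; apply: pr_constt => //.
apply: contraL dvd_px => p'x; rewrite -prime_coprime // coprime_sym.
by rewrite (p'nat_coprime p'x) ?pnat_id.
Qed.

(** A non-permuting pair with least sum of orders satisfies the minimality of [min_noncommuting] on
    both sides. The two primes agree because subgroups of coprime orders in a nilpotent group
    centralise each other. *)
Lemma nonpermutable_pair G : nilpotent G -> ~~ permutable G ->
  exists p x y, [/\ prime p, x \in G /\ y \in G, p.-elt x /\ p.-elt y,
      ~ commute <[x]> <[y]>
    & [/\ commute <[x ^+ p]> <[y]>, commute <[x]> <[y ^+ p]>
        & commute <[x ^+ p]> <[y ^+ p]>]].
Proof.
move=> nilG nperG.
pose bad (P : {group gT} * {group gT}) :=
  [&& P.1 \subset G, P.2 \subset G & P.1 * P.2 != P.2 * P.1 :> {set gT}].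
have [P0 badP0] : exists P, bad P.
  move: nperG; rewrite negb_forall => /existsP[H]; rewrite negb_forall => /existsP[K].
  by rewrite negb_imply -andbA => ?; exists (H, K).
pose ord2 (P : {group gT} * {group gT}) := (#|P.1| + #|P.2|)%N.
have [[H K] /and3P[/= sHG sKG /eqP ncHK] minHK] := arg_minnP ord2 badP0.
have cHK' H' K' : H' \subset H -> K' \subset K -> (H' \proper H) || (K' \proper K) ->
    commute H' K'.
  move=> sH' sK' prHK; apply/eqP; apply: contraT => ncHK'.
  have := minHK (H', K'); rewrite /bad /ord2 /= (subset_trans sH') // (subset_trans sK') //.
  move/(_ ncHK'); rewrite leqNgt; case/orP: prHK => /proper_card lt.
    by rewrite -addSn leq_add ?subset_leq_card.
  by rewrite -addnS leq_add ?subset_leq_card.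
have [|//|p [x [p_pr defH px ntx]]] := @min_noncommuting H K.
  by move=> L prL; apply: cHK'; rewrite ?prL ?(proper_sub prL).
have [||q [y [q_pr defK qy nty]]] := @min_noncommuting K H.
- by move=> L prL; apply/commute_sym/cHK'; rewrite ?prL ?orbT ?(proper_sub prL).
- by move/commute_sym.
have eq_qp : q = p.
  apply/eqP; apply: contraT => neq_qp; case: ncHK; apply: centC.
  apply: sub_nilpotent_cent2 nilG _ _ _ => //.
  rewrite defH defK; apply: pnat_coprime qy _; apply: pi_pnat px _.
  by rewrite !inE eq_sym.
rewrite eq_qp in qy.
have pr_exp (z : gT) : z != 1 -> p.-elt z -> <[z ^+ p]> \proper <[z]>.
  move=> ntz pz; rewrite properEcard cycle_subG mem_cycle -!orderE.
  have [_ p_dv _] : [/\ prime p, p %| #[z] & True].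
    by have [|? ? _] := pgroup_pdiv pz; rewrite ?cycle_eq1.
  by rewrite orderXdiv // ltn_Pdiv ?prime_gt1.
exists p, x, y; rewrite -!cycle_subG -defH -defK; split=> //.
have prx := pr_exp x ntx px; have pry := pr_exp y nty qy.
rewrite -defH in prx; rewrite -defK in pry.
split; first by apply: (cHK' <[x ^+ p]>%G K); rewrite /= ?prx ?(proper_sub prx).
  by apply: (cHK' H <[y ^+ p]>%G); rewrite /= ?pry ?orbT ?(proper_sub pry).
by apply: (cHK' <[x ^+ p]>%G <[y ^+ p]>%G); rewrite /= ?prx ?(proper_sub prx) ?(proper_sub pry).
Qed.

(* The configuration behind the sections [D_8] and [p^(1+2)]. *)
Lemma nonpermutable_section G : nilpotent G -> ~~ permutable G ->
  exists p x y K, [/\ prime p, <[x]> <*> <[y]> \subset G,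
      p.-group (<[x]> <*> <[y]>), K <| <[x]> <*> <[y]>
    & [/\ x ^+ p \in K, y ^+ p \in K & ~~ abelian (<[x]> <*> <[y]> / K)]].
Proof.
move=> nilG /(nonpermutable_pair nilG)[p [x [y]]].
case=> p_pr [Gx Gy] [px py] ncXY [cX1Y cXY1 cX1Y1].
set X := <[x]> in ncXY cXY1 *; set Y := <[y]> in ncXY cX1Y *.
pose X1 := <[x ^+ p]>; pose Y1 := <[y ^+ p]>.
pose K := (X1 <*> Y1)%G; have defK : K :=: X1 * Y1 by rewrite /= comm_joingE.
have sXY : X <*> Y \subset G by rewrite join_subG !cycle_subG Gx.
have pXY : p.-group (X <*> Y).
  apply: pgroupS (pcore_pgroup p G); have hallO := nilpotent_pcore_Hall p nilG.
  by rewrite join_subG !cycle_subG !(mem_normal_Hall hallO) ?pcore_normal ?Gx ?Gy ?px.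
(* Here [K * Z] is a [p]-group in which [K] has index 1 or [p], so [K] is normal in it. *)
have normK (z : gT) (Z := <[z]>%G) : z \in X <*> Y -> commute K Z -> z ^+ p \in K -> 
    Z \subset 'N(K).
  move=> XYz cKZ Kzp; have sKZ : K \subset K <*> Z := joing_subl K Z.
  have sKZXY : K <*> Z \subset X <*> Y.
    rewrite join_subG cycle_subG XYz andbT join_subG !cycle_subG.
    by rewrite !groupX // mem_gen // inE cycle_id ?orbT.
  have pKZ := pgroupS sKZXY pXY.
  have idx : #|K <*> Z : K| %| p.
    rewrite comm_joingE // indexMg; apply: dvdn_trans (_ : #|Z : <[z ^+ p]>| %| p).
      by apply: indexgS; rewrite cycle_subG.
    rewrite -divgS ?cycle_subG ?mem_cycle // -!orderE orderXgcd.
    rewrite -{1}(divnK (dvdn_gcdl #[z] p)) mulKn ?dvdn_gcdr //.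
    by rewrite divn_gt0 ?gcdn_gt0 ?order_gt0 // dvdn_leq ?order_gt0 ?dvdn_gcdl.
  have nKZ : K <| K <*> Z.
    case/primeP: (p_pr) => _ /(_ _ idx)/orP[].
      by rewrite indexg_eq1 => sZK; rewrite /normal sKZ (subset_trans sZK) ?normG.
    move/eqP=> idxp; apply: p_maximal_normal pKZ _; apply: p_index_maximal sKZ _.
    by rewrite idxp.
  exact: subset_trans (joing_subr _ _) (normal_norm nKZ).
have cXX1 : commute X1 X.
  by apply/centC/(sub_abelian_cent2 (cycle_abelian x));
    rewrite cycle_subG ?mem_cycle ?cycle_id.
have cYY1 : commute Y1 Y.
  by apply/centC/(sub_abelian_cent2 (cycle_abelian y));
    rewrite cycle_subG ?mem_cycle ?cycle_id.
have sX1X : X1 * X = X by apply: mulSGid; rewrite cycle_subG mem_cycle.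
have sY1Y : Y1 * Y = Y by apply: mulSGid; rewrite cycle_subG mem_cycle.
have nKX : X \subset 'N(K).
  apply: normK; first by rewrite mem_gen // inE cycle_id.
    by rewrite defK; apply: commute_mulG.
  by rewrite mem_gen // inE cycle_id.
have nKY : Y \subset 'N(K).
  apply: normK; first by rewrite mem_gen // inE cycle_id orbT.
    by rewrite defK; apply: commute_mulG.
  by rewrite mem_gen // inE cycle_id orbT.
have sX1XY : X1 \subset X <*> Y by rewrite cycle_subG groupX // mem_gen // inE cycle_id.
have sY1XY : Y1 \subset X <*> Y.
  by rewrite cycle_subG groupX // mem_gen // inE cycle_id orbT.
exists p, x, y, K; split=> //.
  by rewrite /normal !join_subG nKX nKY sX1XY sY1XY.
split; try by rewrite mem_gen // inE cycle_id ?orbT.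
apply: contra_notN ncXY; rewrite quotientY // => abXY.
have cXYK : commute (X / K) (Y / K).
  apply: centC; apply: subset_trans (joing_subl _ _) _.
  by apply: subset_trans abXY _; rewrite centS ?joing_subr.
(* Pulling back gives [K * (X * Y) = K * (Y * X)]. Moving [X1] and [Y1] past [Y] and [X] absorbs
   [K = X1 * Y1] on both sides, leaving [X * Y = Y * X]. *)
have := congr1 (fun A => coset K @*^-1 A) cXYK.
rewrite -!quotientMl // !quotientK ?mul_subG // defK.
rewrite -!mulgA [Y1 * (X * Y)]mulgA -cXY1 -mulgA sY1Y mulgA sX1X.
by rewrite [Y1 * (Y * X)]mulgA sY1Y mulgA cX1Y -mulgA sX1X.
Qed.

End Permutable.

Lemma card_quotient_cycle (gT : finGroupType) (K : {group gT}) (x : gT) p :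
  prime p -> x \in 'N(K) -> x ^+ p \in K -> #|<[x]> / K| %| p.
Proof.
move=> p_pr nKx Kxp; rewrite quotient_cycle // -orderE order_dvdn -morphX //=.
by rewrite coset_id.
Qed.

(** In the section [H / K] of a non-permuting pair, let [M] be a maximal subgroup of [H] containing
    [L = <[x]> K]. The modular law forces [M = L], so [|H / K|] divides [p ^ 2] and [H / K] is
    abelian, a contradiction. *)
Lemma modular_permutable (gT : finGroupType) (G : {group gT}) :
  nilpotent G -> modular_subgroup_lattice G -> permutable G.
Proof.
move=> nilG modG; apply: contraT => /(nonpermutable_section nilG).
case=> p [x [y [K [p_pr sHG pH nsKH [Kxp Kyp nabHK]]]]].
set H := <[x]> <*> <[y]> in sHG pH nsKH nabHK.
have [sKH nKH] := andP nsKH.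
have Hx : x \in H by rewrite mem_gen // inE cycle_id.
have Hy : y \in H by rewrite mem_gen // inE cycle_id orbT.
have nKx := subsetP nKH _ Hx; pose L := (<[x]> <*> K)%G.
have nKX : <[x]> \subset 'N(K) by rewrite cycle_subG.
have quoL : L / K = <[x]> / K by rewrite quotientYidr.
have sLH : L \subset H by rewrite join_subG cycle_subG Hx.
have [eqLH|[M maxM sLM]] := maximal_exists sLH.
  by case/negP: nabHK; rewrite -[H]eqLH quoL quotient_abelian ?cycle_abelian.
have sMH := proper_sub (maxgroupp maxM).
have sKM : K \subset M := subset_trans (joing_subr _ _) sLM.
have Mx : x \in M by rewrite -cycle_subG (subset_trans (joing_subl _ _) sLM).
have notMy : y \notin M.
  apply/negP=> My; have := maxgroupp maxM.
  by rewrite properE join_subG !cycle_subG Mx My andbF.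
(* A power of [y] with exponent prime to [p] generates [<[y]>], so it is not in [M]; all other
   powers are powers of [y ^+ p]. *)
have sYMK : <[y]> :&: M \subset K.
  apply/subsetP=> _ /setIP[/cycleP[k ->] Myk].
  have [/dvdnP[i ->]|p'k] := boolP (p %| k); first by rewrite mulnC expgM groupX.
  case/negP: notMy; rewrite -cycle_subG.
  suff -> : <[y]> = <[y ^+ k]> by rewrite cycle_subG.
  apply/eqP; rewrite [_ == _]generator_coprime.
  have py : p.-elt y := mem_p_elt pH Hy.
  by rewrite (pnat_coprime py) // p'natE.
have defM : M :=: L.
  have := modG L <[y]>%G M (subset_trans sLH sHG) _ (subset_trans sMH sHG) sLM.
  have -> : L <*> <[y]> = H.
    by rewrite /= -joingA [K <*> _]joingC joingA; apply/joing_idPl.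
  rewrite (setIidPr sMH) => -> //; last by rewrite cycle_subG (subsetP sHG).
  by apply/joing_idPl; apply: subset_trans sYMK (joing_subr _ _).
have idxM := p_maximal_index pH maxM.
case/negP: nabHK; apply: p2group_abelian (quotient_pgroup _ pH) _.
have : #|H / K| %| p ^ 2.
  rewrite -(Lagrange (quotientS K sMH)) mulnC expnS expn1 dvdn_mul //.
    by rewrite index_quotient_eq ?idxM // subIset ?sKM ?orbT.
  by rewrite /= defM quoL card_quotient_cycle.
by move/(dvdn_leq_log p); rewrite expn_gt0 prime_gt0 // pfactorK //; apply.
Qed.

(* The product of the two subgroups has order dividing [p ^ 2]. *)
Lemma commute_prime_cycles (gT : finGroupType) (p : nat) (x y : gT) :
  prime p -> #[x] = p -> #[y] = p -> commute <[x]> <[y]> -> commute x y.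
Proof.
move=> p_pr ox oy cxy.
have defXY := comm_joingE (G := <[x]>%G) (H := <[y]>%G) cxy.
have : abelian (<[x]> <*> <[y]>).
  have pX : p.-group (<[x]> <*> <[y]>).
    by rewrite defXY pgroupM /pgroup -!orderE ox oy pnat_id.
  apply: p2group_abelian pX _.
  have : #|<[x]> * <[y]>| %| p ^ 2.
    by rewrite (dvdn_trans (dvdn_cardMg _ _)) // -!orderE ox oy expnS expn1.
  rewrite -defXY => /(dvdn_leq_log p).
  by rewrite expn_gt0 prime_gt0 // pfactorK //; apply.
move/centsP; apply; first by rewrite mem_gen // inE cycle_id.
by rewrite mem_gen // inE cycle_id orbT.
Qed.

(** * Counting in non-abelian groups of order [p ^ 3] generated by elements of order [p] *)

Lemma card_fibers (T1 T2 : finType) (f : T1 -> T2) (A : {set T1}) :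
  #|A| = (\sum_(y in f @: A) #|[set x in A | f x == y]|)%N.
Proof.
rewrite -sum1_card (partition_big_imset f); apply: eq_bigr => y _.
by rewrite -sum1_card; apply: eq_bigl => x; rewrite inE.
Qed.

Section ExtraspecialBound.

Variables (gT : finGroupType) (p : nat) (T : {group gT}) (a b : gT).
Hypotheses (p_pr : prime p) (pT : p.-group T) (defT : <[a]> <*> <[b]> = T).
Hypotheses (ap1 : a ^+ p = 1) (bp1 : b ^+ p = 1) (oT' : #|T^`(1)| = p).

Let Ta : a \in T. Proof. by rewrite -defT mem_gen // inE cycle_id. Qed.
Let Tb : b \in T. Proof. by rewrite -defT mem_gen // inE cycle_id orbT. Qed.

Let nabT : ~~ abelian T.
Proof.
by rewrite (sameP derG1P eqP) -cardG_gt1 oT' prime_gt1.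
Qed.

Lemma der1_central : T^`(1) \subset 'Z(T).
Proof.
apply: prime_meetG; rewrite ?oT' //.
by rewrite meet_center_nil ?(pgroup_nil pT) ?der_normal // -cardG_gt1 oT' prime_gt1.
Qed.

(** The derived quotient is abelian and generated by two elements of order dividing [p], so
    [|T| <= p ^ 3]; a [p]-group of order at most [p ^ 2] is abelian. *)
Lemma card_p3 : #|T| = (p ^ 3)%N.
Proof.
have [n oT] := p_natP pT; rewrite oT; congr (_ ^ _)%N; apply/eqP; rewrite eqn_leq.
apply/andP; split; last first.
  by rewrite ltnNge; apply: contra nabT => le_n2;
    apply: p2group_abelian pT _; rewrite oT pfactorK.
rewrite -(leq_exp2l _ _ (prime_gt1 p_pr)) -oT -(Lagrange (der_sub 1 T)) oT' expnS.
rewrite leq_mul2l -card_quotient ?der_norm //; apply/orP; right.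
have nT'x x : x \in T -> x \in 'N(T^`(1)) by apply: subsetP (der_norm 1 T) x.
rewrite -[in X in X / _]defT quotientY ?cycle_subG ?nT'x // cent_joinEl; last first.
  apply: (sub_abelian_cent2 (der_abelian 0 T)); rewrite quotientS // cycle_subG //.
apply: leq_trans (dvdn_leq _ (dvdn_cardMg _ _)) _; first by rewrite muln_gt0 !cardG_gt0.
rewrite expnS expn1 leq_mul // dvdn_leq ?prime_gt0 // card_quotient_cycle ?nT'x //.
  by rewrite ap1 group1.
by rewrite bp1 group1.
Qed.


Let ncab : a * b != b * a.
Proof.
apply: contra nabT => /eqP cab; rewrite -defT cent_joinEl ?cents_cycle //.
by rewrite abelianM !cycle_abelian cents_cycle.
Qed.

Lemma noncommuting_cycles_in x y : x \in T -> y \in T -> x ^+ p = 1 -> y ^+ p = 1 ->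
  x * y != y * x -> (<[x]>%G, <[y]>%G) \in noncommuting_cyclic_pairs T.
Proof.
move=> Tx Ty xp1 yp1 ncxy; rewrite inE /= !cycle_cyclic_subgroup //=.
have ox : #[x] = p.
  apply/prime_nt_dvdP; rewrite // ?order_dvdn ?xp1 // order_eq1.
  by apply: contraNneq ncxy => ->; rewrite mulg1 mul1g.
have oy : #[y] = p.
  apply/prime_nt_dvdP; rewrite // ?order_dvdn ?yp1 // order_eq1.
  by apply: contraNneq ncxy => ->; rewrite mulg1 mul1g.
by apply: contra ncxy => /eqP cXY; apply/eqP; apply: (commute_prime_cycles p_pr) cXY.
Qed.

(** The dihedral group of order 8, source of the constant: at most 7 cyclic subgroups and at least 8
    non-permuting ordered pairs, and [8 * 7 ^ 2 = 49 * 8]. *)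
Lemma csd_le_order8 : p = 2 -> (csd T <= 41%:R / 49%:R)%R.
Proof.
move=> p2; have sqr1V (x : gT) : x ^+ p = 1 -> x^-1 = x.
  by move=> xp1; apply/eqP; rewrite eq_invg_mul -xp1 p2.
pose z := [~ a, b]; have zZ : z \in 'Z(T).
  by apply: (subsetP der1_central); apply: mem_commg.
have ntz : z != 1 by apply: contra ncab => /commgP/eqP.
have [Tz cTz] := centerP _ _ zZ.
have zp1 : z ^+ p = 1.
  by apply/eqP; rewrite -order_dvdn -oT' order_dvdG // mem_commg.
have azp1 x : x \in T -> x ^+ p = 1 -> (x * z) ^+ p = 1.
  by move=> Tx xp1; rewrite expgMn; [rewrite xp1 zp1 mulg1 | apply/commute_sym/cTz].
have cyc_inj (x y : gT) : #[x] = p -> #[y] = p -> <[x]>%G = <[y]>%G -> x = y.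
  rewrite p2 => ox oy /(congr1 val)/= eqxy; have : x \in <[y]> by rewrite -eqxy cycle_id.
  by rewrite cycle2g // !inE => /pred2P[x1|//]; rewrite x1 order1 in ox.
have leN : #|cyclic_subgroups T| <= 7.
  have sN : cyclic_subgroups T \subset [set <[x]>%G | x in T :\ (b * a)].
    apply/subsetP=> C; rewrite mem_cyclic_subgroups => /andP[+ /cyclicP[x defC]].
    have -> : C = <[x]>%G by apply/val_inj.
    rewrite /= cycle_subG => Tx; have [->|ne] := eqVneq x (b * a); last first.
      by apply/imset_f; rewrite !inE ne.
    apply/imsetP; exists (a * b); first by rewrite !inE ncab groupM.
    by apply/val_inj; rewrite /= -cycleV invMg !sqr1V.
  apply: leq_trans (subset_leq_card sN) (leq_trans (leq_imset_card _ _) _).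
  have := cardsD1 (b * a) T; rewrite groupM // card_p3 p2.
  by move=> e; rewrite -ltnS -[_.+1]add1n -e.
have cen u w : u \in 'Z(T) -> w \in T -> u * w = w * u.
  by case/centerP=> _; apply.
have zmul c x : x \in [set c; c * z] -> exists2 u, u \in 'Z(T) & x = c * u.
  by case/set2P=> ->; [exists 1; rewrite ?group1 ?mulg1 | exists z].
(* Central factors cancel, so this reduces to [a * b != b * a]. Two choices on each side, in both
   orders, give the 8 pairs. *)
have nc x y : x \in [set a; a * z] -> y \in [set b; b * z] -> x * y != y * x.
  case/zmul=> u Zu -> /zmul[v Zv ->].
  have [Tu Tv] := (subsetP (center_sub T) u Zu, subsetP (center_sub T) v Zv).
  have -> : a * u * (b * v) = a * b * (u * v).
    by rewrite -!mulgA [u * (b * v)]mulgA (cen u b) // -!mulgA.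
  have -> : b * v * (a * u) = b * a * (u * v).
    by rewrite -!mulgA [v * (a * u)]mulgA (cen v a) // -!mulgA (cen v u).
  by rewrite (inj_eq (mulIg _)).
have exp_p c x : c \in T -> c ^+ p = 1 -> x \in [set c; c * z] -> x \in T /\ x ^+ p = 1.
  by move=> Tc cp1 /set2P[] ->; split=> //; [apply: groupM | apply: azp1].
have ord_nc (x y : gT) : x ^+ p = 1 -> x * y != y * x -> #[x] = p.
  move=> xp1 ncxy; apply/prime_nt_dvdP; rewrite // ?order_dvdn ?xp1 // order_eq1.
  by apply: contraNneq ncxy => ->; rewrite mulg1 mul1g.
have ordA x : x \in [set a; a * z] -> #[x] = p.
  move=> Ax; apply: (ord_nc x b); first by have [] := exp_p a x Ta ap1 Ax.
  by apply: nc => //; rewrite set21.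
have ordB x : x \in [set b; b * z] -> #[x] = p.
  move=> Bx; apply: (ord_nc x a); first by have [] := exp_p b x Tb bp1 Bx.
  by rewrite eq_sym; apply: nc => //; rewrite set21.
have neq_z c : c != c * z by rewrite -{1}[c]mulg1 (inj_eq (mulgI c)) eq_sym.
pose A := [set <[x]>%G | x in [set a; a * z]].
pose B := [set <[x]>%G | x in [set b; b * z]].
have cA : #|A| = 2.
  rewrite card_in_imset ?cards2 ?neq_z // => x y Ax Ay.
  by apply: cyc_inj; apply: ordA.
have cB : #|B| = 2.
  rewrite card_in_imset ?cards2 ?neq_z // => x y Ax Ay.
  by apply: cyc_inj; apply: ordB.
have sAB : setX A B :|: setX B A \subset noncommuting_cyclic_pairs T.
  apply/subsetP=> -[X Y] /setUP[] /setXP[/imsetP[x Ax ->] /imsetP[y By ->]].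
    have [[Tx xp1] [Ty yp1]] := (exp_p a x Ta ap1 Ax, exp_p b y Tb bp1 By).
    by apply: noncommuting_cycles_in; rewrite ?nc.
  have [[Tx xp1] [Ty yp1]] := (exp_p b x Tb bp1 Ax, exp_p a y Ta ap1 By).
  by apply: noncommuting_cycles_in; rewrite // eq_sym nc.
have := subset_leq_card sAB; rewrite cardsU !cardsX cA cB.
have -> : setX A B :&: setX B A = set0.
  apply/setP=> -[X Y]; rewrite !inE /=; apply/negP=> /andP[/andP[+ _] /andP[+ _]].
  case/imsetP=> x Ax -> /imsetP[y By eq_xy].
  have := nc x y Ax By; rewrite (cyc_inj x y _ _ eq_xy) ?eqxx //; [exact: ordA | exact: ordB].
rewrite cards0 => le8; apply: csd_le_bound.
apply: leq_trans (_ : 8 * 7 ^ 2 <= _)%N; first by rewrite leq_mul2l leq_exp2r.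
by apply: leq_trans (_ : 49 * 8 <= _)%N; rewrite // leq_mul2l.
Qed.

Hypothesis odd_p : odd p.

(** [T] has class at most 2 and is generated by elements of order [p]; for odd [p] the subgroup
    ['Ohm_1(T)] then has exponent dividing [p]. *)
Lemma order_p3_exponent x : x \in T -> x ^+ p = 1.
Proof.
move=> Tx; have defO : 'Ohm_1(T) = T.
  apply/eqP; rewrite eqEsubset Ohm_sub /=.
  apply: subset_trans (_ : <[a]> <*> <[b]> \subset _); first by rewrite defT.
  rewrite join_subG !cycle_subG /= (OhmE 1 pT) expn1.
  by rewrite !mem_gen // inE ?Ta ?Tb inE ?ap1 ?bp1 eqxx.
have := exponent_Ohm1_class2 odd_p pT; rewrite nil_class2 der1_central defO.
by move=> /(_ isT)/exponentP; apply.
Qed.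

Let card_cyclic (C : {group gT}) : C \in cyclic_subgroups T -> C :!=: 1 -> #|C| = p.
Proof.
rewrite mem_cyclic_subgroups => /andP[+ /cyclicP[c defC]]; rewrite defC cycle_subG.
move=> Tc ntc; apply/prime_nt_dvdP; rewrite // -?orderE ?order_eq1 -?cycle_eq1 //.
by rewrite order_dvdn order_p3_exponent.
Qed.

Let card_generators (C : {group gT}) :
  C \in cyclic_subgroups T :\ 1%G -> #|[set x in T^# | <[x]>%G == C]| = p.-1.
Proof.
case/setD1P=> ntC cycC; have oC := card_cyclic cycC ntC.
have <- : #|C^#| = p.-1 by rewrite -oC (cardsD1 1 C) group1.
apply: eq_card => x; rewrite !inE; apply/idP/idP=> [/andP[/andP[-> _] /eqP<-]|].
  exact: cycle_id.
case/andP=> ntx Cx; have [sCT _] := andP (etrans (esym (mem_cyclic_subgroups T C)) cycC).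
rewrite ntx (subsetP sCT) //=; apply/eqP/val_inj/eqP; rewrite /= eqEcard cycle_subG Cx oC /=.
have Tx := subsetP sCT x Cx.
by rewrite (card_cyclic (cycle_cyclic_subgroup Tx)) // cycle_eq1.
Qed.

Let proper_card_le (H : {group gT}) : H \proper T -> #|H| <= p ^ 2.
Proof.
move=> prH; have := cardSg (proper_sub prH); rewrite card_p3.
case/(dvdn_pfactor _ _ p_pr)=> k le_k oH; have := proper_card prH.
by rewrite card_p3 oH ltn_exp2l ?leq_exp2l ?prime_gt1.
Qed.

(** The [p^3 - 1] non-identity elements fall into classes of [p - 1] generators, which gives
    [p^2 + p + 2] cyclic subgroups. *)
Let card_cyclic_subgroups_le : #|cyclic_subgroups T| <= 2 * p ^ 2.
Proof.
have defI : [set <[x]>%G | x in T^#] = cyclic_subgroups T :\ 1%G.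
  apply/setP=> C; apply/imsetP/setD1P=> [[x /setD1P[ntx Tx] ->]|[ntC]].
    split; last exact: cycle_cyclic_subgroup.
    by apply: contraNneq ntx => /(congr1 val)/eqP; rewrite /= cycle_eq1.
  rewrite mem_cyclic_subgroups => /andP[sCT /cyclicP[c defC]].
  have defC' : C = <[c]>%G by apply/val_inj.
  exists c => //; rewrite !inE -cycle_subG -defC sCT andbT -cycle_eq1 -defC.
  exact: ntC.
have := card_fibers (fun x => <[x]>%G) T^#; rewrite defI.
rewrite (eq_bigr (fun _ => p.-1)) => [|C CT]; last exact: card_generators.
rewrite sum_nat_const; have := cardsD1 1 T; rewrite group1 card_p3 => eT.
have := cardsD1 1%G (cyclic_subgroups T).
rewrite mem_cyclic_subgroups sub1G cyclic1 /= => eC.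
have := prime_gt1 p_pr; move: eT eC; move: #|_| #|_| #|_| => c n t.
rewrite !expnS expn0 muln1; case: (p) => [|[|q]] //= eT eC _ eqt.
nia.
Qed.

(** Count non-commuting pairs of elements: at least [p^3 - p^2] choices outside the centre, then as
    many outside the centraliser of the first. Each pair of subgroups arises from at most
    [(p - 1)^2] of them, and [(p^3 - p^2)^2 = p^4 (p - 1)^2]. *)
Let card_noncommuting_ge : p ^ 4 <= #|noncommuting_cyclic_pairs T|.
Proof.
pose A := [set P : gT * gT | [&& P.1 \in T, P.2 \in T & P.1 * P.2 != P.2 * P.1]].
pose F (P : gT * gT) := (<[P.1]>%G, <[P.2]>%G).
have A_T P : P \in A -> [/\ P.1 \in T, P.2 \in T & P.1 * P.2 != P.2 * P.1].
  by rewrite inE => /and3P.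
have leA : #|A| <= #|noncommuting_cyclic_pairs T| * (p.-1 * p.-1).
  have sFA : F @: A \subset noncommuting_cyclic_pairs T.
    apply/subsetP=> _ /imsetP[P /A_T[T1 T2 ncP] ->].
    by apply: noncommuting_cycles_in; rewrite ?order_p3_exponent.
  apply: leq_trans (_ : _ <= #|F @: A| * (p.-1 * p.-1)) _;
    last by rewrite leq_mul2r subset_leq_card ?orbT.
  rewrite (card_fibers F) -sum_nat_const; apply: leq_sum => _ /imsetP[P AP ->].
  have [T1 T2 ncP] := A_T P AP.
  have nt_of Q : Q \in A -> Q.1 \in T^# /\ Q.2 \in T^#.
    case/A_T=> TQ1 TQ2 ncQ; rewrite !inE TQ1 TQ2 !andbT.
    by split; apply: contraNneq ncQ => ->; rewrite mulg1 mul1g.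
  have gens x : x \in T^# -> <[x]>%G \in cyclic_subgroups T :\ 1%G.
    case/setD1P=> ntx Tx; rewrite in_setD1 cycle_cyclic_subgroup // andbT.
    by apply: contraNneq ntx => /(congr1 val)/eqP; rewrite /= cycle_eq1.
  have [ntP1 ntP2] := nt_of P AP.
  rewrite -{1}(card_generators (gens _ ntP1)) -(card_generators (gens _ ntP2)) -cardsX.
  apply/subset_leq_card/subsetP=> Q; rewrite inE => /andP[AQ /eqP[eq1 eq2]].
  have [ntQ1 ntQ2] := nt_of Q AQ.
  rewrite inE [in X in X && _]in_set ntQ1 [in X in _ && X]in_set ntQ2 /=.
  by apply/andP; split; apply/eqP/val_inj.
have geA : (p ^ 3 - p ^ 2) * (p ^ 3 - p ^ 2) <= #|A|.
  have lt_p23 (H : {group gT}) : H \proper T -> p ^ 3 - p ^ 2 <= #|T :\: H|.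
    move=> prH; rewrite cardsD (setIidPr (proper_sub prH)) card_p3.
    by rewrite leq_sub2l ?proper_card_le.
  have prZ : 'Z(T) \proper T.
    rewrite properEneq center_sub andbT; apply: contra nabT => /eqP defZ.
    by rewrite -defZ center_abelian.
  have fstA x : x \in T -> x \notin 'Z(T) -> exists2 y, y \in T & (x, y) \in A.
    move=> Tx; rewrite in_setI Tx /= -sub_cent1 => /subsetPn[y Ty ncy]; exists y => //.
    by rewrite !inE Tx Ty /=; apply: contra ncy => /eqP cxy; apply/cent1P.
  have sZA : T :\: 'Z(T) \subset fst @: A.
    apply/subsetP=> x /setDP[Tx notZx]; have [y _ Axy] := fstA x Tx notZx.
    by apply/imsetP; exists (x, y).
  rewrite (card_fibers fst); apply: leq_trans (_ : _ <= #|fst @: A| * (p ^ 3 - p ^ 2)) _.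
    by rewrite leq_mul2r (leq_trans (lt_p23 'Z(T)%G prZ)) ?orbT // subset_leq_card.
  rewrite -sum_nat_const; apply: leq_sum => _ /imsetP[P /A_T[Tx Ty ncP] ->].
  set x := P.1 in Tx ncP *.
  have prC : 'C_T[x] \proper T.
    rewrite properE subsetIl subsetI subxx /=; apply: contra ncP => /subsetP/(_ _ Ty).
    by move/cent1P=> ->.
  apply: leq_trans (lt_p23 'C_T[x]%G prC) _.
  rewrite -(card_imset (T :\: 'C_T[x]) (_ : injective (pair x))); last by move=> ? ? [].
  apply/subset_leq_card/subsetP=> _ /imsetP[y /setDP[Ty' ncy] ->].
  rewrite !inE Tx Ty' eqxx andbT /=; apply: contra ncy => /eqP cxy.
  by rewrite inE Ty'; apply/cent1P.
have := leq_trans geA leA; have p_gt1 := prime_gt1 p_pr.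
have -> : (p ^ 3 - p ^ 2 = p ^ 2 * p.-1)%N.
  by rewrite [X in X - _]expnSr -[X in _ - X]muln1 -mulnBr subn1.
by rewrite mulnACA leq_pmul2r ?muln_gt0 -?expnD // -subn1 subn_gt0 p_gt1.
Qed.

Lemma csd_lt_exponent_p : (csd T < 41%:R / 49%:R)%R.
Proof.
apply: csd_lt_bound; have p_gt0 := prime_gt0 p_pr.
apply: leq_ltn_trans (_ : 8 * (2 * p ^ 2) ^ 2 < _)%N.
  by rewrite leq_mul2l leq_exp2r.
apply: leq_trans (_ : 49 * p ^ 4 <= _)%N; last by rewrite leq_mul2l.
by rewrite expnMn -expnM mulnA ltn_pmul2r // expn_gt0 p_gt0.
Qed.

End ExtraspecialBound.

(** The counts need a derived subgroup of order [p]; dividing by a normal subgroup [N] of [H] that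
    has index [p] in the derived subgroup achieves this. *)
Lemma csd_star_nonabelian_pgroup (gT : finGroupType) (p : nat) (H : {group gT}) (a b : gT) :
    prime p -> p.-group H -> <[a]> <*> <[b]> = H -> a ^+ p = 1 -> b ^+ p = 1 ->
    ~~ abelian H ->
  (csd_star H <= 41%:R / 49%:R)%R /\ (odd p -> (csd_star H < 41%:R / 49%:R)%R).
Proof.
move=> p_pr pH defH ap1 bp1 nabH.
have [||N [sNH' nsNH oN]] := @normal_pgroup p _ (logn p #|H^`(1)|).-1 H H^`(1)%G pH.
- exact: der_normal.
- exact: leq_pred.
have nHN := normal_norm nsNH.
have Ha : a \in H by rewrite -defH mem_gen // inE cycle_id.
have Hb : b \in H by rewrite -defH mem_gen // inE cycle_id orbT.
have oT' : #|(H / N)^`(1)| = p.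
  rewrite -quotient_der // card_quotient ?(subset_trans (der_sub 1 H)) // -divgS //.
  rewrite oN; have pH' := pgroupS (der_sub 1 H) pH.
  have ntH' : H^`(1) != 1 by rewrite -(sameP derG1P eqP).
  have [_ p_dv _] := pgroup_pdiv pH' ntH'.
  have lt0 : 0 < logn p #|H^`(1)| by rewrite logn_gt0 mem_primes p_pr cardG_gt0.
  by rewrite {1}(card_pgroup pH') -{1}(prednK lt0) expnS mulnK ?expn_gt0 ?prime_gt0.
have defT : <[coset N a]> <*> <[coset N b]> = H / N.
  have [nNa nNb] := (subsetP nHN a Ha, subsetP nHN b Hb).
  by rewrite -!quotient_cycle // -quotientY ?cycle_subG ?defH.
have exp_coset x : x \in H -> x ^+ p = 1 -> coset N x ^+ p = 1.
  by move=> Hx xp1; rewrite -morphX ?(subsetP nHN) //= xp1 morph1.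
have pT : p.-group (H / N) := quotient_pgroup N pH.
have le_csd : (csd_star H <= csd (H / N)%g)%R.
  exact: csd_star_le (subxx _) nsNH.
have [ap bp] := (exp_coset a Ha ap1, exp_coset b Hb bp1).
have lt_odd : odd p -> (csd (H / N)%g < 41%:R / 49%:R)%R.
  exact: (csd_lt_exponent_p (T := (H / N)%G)) p_pr pT defT ap bp oT'.
split=> [|odd_p]; last exact: le_lt_trans le_csd (lt_odd odd_p).
apply: le_trans le_csd _; have [p2|odd_p] := even_prime p_pr.
  exact: (csd_le_order8 (T := (H / N)%G)) p_pr pT defT ap bp oT' p2.
exact: ltW (lt_odd odd_p).
Qed.

Lemma csd_star_nonpermutable (gT : finGroupType) (G : {group gT}) :
    nilpotent G -> ~~ permutable G ->
  (csd_star G <= 41%:R / 49%:R)%R /\ (odd #|G| -> (csd_star G < 41%:R / 49%:R)%R).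
Proof.
move=> nilG /(nonpermutable_section nilG)[p [x [y [K]]]].
case=> p_pr sHG pH nsKH [Kxp Kyp nabHK].
set H := (<[x]> <*> <[y]>)%G in sHG pH nsKH nabHK.
have nKH := normal_norm nsKH.
have nKx : x \in 'N(K) by rewrite (subsetP nKH) // mem_gen // inE cycle_id.
have nKy : y \in 'N(K) by rewrite (subsetP nKH) // mem_gen // inE cycle_id orbT.
have le_star : (csd_star G <= csd_star (H / K)%G)%R.
  exact: le_trans (csd_starS sHG) (csd_star_quotient nKH).
have [|||||le_csd lt_csd] :=
  @csd_star_nonabelian_pgroup _ p (H / K)%G (coset K x) (coset K y) p_pr.
- exact: quotient_pgroup.
- by rewrite /= quotientY ?cycle_subG // !quotient_cycle.
- by rewrite -morphX //= coset_id.
- by rewrite -morphX //= coset_id.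
- exact: nabHK.
split; first exact: le_trans le_star le_csd.
move=> oddG; apply: le_lt_trans le_star (lt_csd _).
have ntH : H :!=: 1.
  by apply: contraNneq nabHK => H1; rewrite /= -/H H1 quotient1 abelian1.
have [_ p_dv _] := pgroup_pdiv pH ntH.
exact: dvdn_odd (dvdn_trans p_dv (cardSg sHG)) oddG.
Qed.

(** * Coprime direct products *)

Section CoprimeProduct.

Variables (gT : finGroupType) (pi : nat_pred) (T U V : {group gT}).
Hypotheses (defT : U \x V = T) (piU : pi.-group U) (pi'V : pi^'.-group V).
Hypothesis perV : permutable V.

Let cUV : V \subset 'C(U). Proof. by case/dprodP: defT. Qed.
Let tiUV : U :&: V = 1. Proof. by case/dprodP: defT. Qed.
Let mulUV : U * V = T. Proof. by case/dprodP: defT. Qed.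

Let mulI_l (A B : {set gT}) : A \subset U -> B \subset V -> 1 \in B -> A * B :&: U = A.
Proof.
move=> sAU sBV B1; apply/setP=> x; apply/setIP/idP=> [[/mulsgP[u v Au Bv ->] Uuv]|Ax].
  suff -> : v = 1 by rewrite mulg1.
  apply/set1gP; rewrite -tiUV inE (subsetP sBV) // andbT.
  by rewrite -(groupMl _ (subsetP sAU u Au)).
by split; [rewrite -[x]mulg1 mem_mulg | rewrite (subsetP sAU)].
Qed.

Let mulI_r (A B : {set gT}) : A \subset U -> B \subset V -> 1 \in A -> A * B :&: V = B.
Proof.
move=> sAU sBV A1; apply/setP=> x; apply/setIP/idP=> [[/mulsgP[u v Au Bv ->] Vuv]|Bx].
  suff -> : u = 1 by rewrite mul1g.
  apply/set1gP; rewrite -tiUV inE (subsetP sAU) //=.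
  by rewrite -(groupMr _ (subsetP sBV v Bv)).
by split; [rewrite -[x]mul1g mem_mulg | rewrite (subsetP sBV)].
Qed.

Let F (H K : {group gT}) := (H <*> K)%G.

Let FE (H K : {group gT}) : H \subset U -> K \subset V -> F H K :=: H * K.
Proof.
move=> sHU sKV; rewrite /= cent_joinEr //.
by rewrite (subset_trans sKV) // (subset_trans cUV) // centS.
Qed.

Let F_inj (H K H' K' : {group gT}) :
  H \subset U -> K \subset V -> H' \subset U -> K' \subset V ->
  F H K = F H' K' -> H = H' /\ K = K'.
Proof.
move=> sH sK sH' sK' /(congr1 val)/=; rewrite -/(F H K) -/(F H' K') !FE // => eqF.
split; apply/val_inj.
  by have := congr1 (fun A => A :&: U) eqF; rewrite !mulI_l.
by have := congr1 (fun A => A :&: V) eqF; rewrite !mulI_r.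
Qed.

Let cyclicF : cyclic_subgroups T
   = (fun P => F P.1 P.2) @: setX (cyclic_subgroups U) (cyclic_subgroups V).
Proof.
apply/setP=> H; apply/idP/imsetP=> [|[[H1 H2] /setXP[]]]; last first.
  rewrite !mem_cyclic_subgroups => /andP[sH1 cH1] /andP[sH2 cH2] ->.
  rewrite FE // -mulUV mulgSS //= cyclicM //.
    by rewrite (subset_trans sH2) // (subset_trans cUV) // centS.
  exact: pnat_coprime (pgroupS sH1 piU) (pgroupS sH2 pi'V).
rewrite mem_cyclic_subgroups => /andP[sHT cH].
exists ((H :&: U)%G, (H :&: V)%G).
  by rewrite in_setX !mem_cyclic_subgroups /= !subsetIr !(cyclicS (subsetIl _ _) cH).
apply/val_inj; rewrite /= -/(F (H :&: U) (H :&: V)) FE ?subsetIr //=.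
apply/eqP; rewrite eqEsubset mul_subG ?subsetIl // andbT.
have [hallU hallV] := coprime_mulpG_Hall mulUV piU pi'V.
have [nsU nsV] := dprod_normal2 defT.
apply/subsetP=> h Hh; have Th := subsetP sHT h Hh.
rewrite -(consttC pi h) mem_mulg // inE groupX //.
  by rewrite (mem_normal_Hall hallU) ?p_elt_constt ?groupX.
by rewrite (mem_normal_Hall hallV) ?p_elt_constt ?groupX.
Qed.

(** Factors from [U] and [V] centralise each other, so the [V]-parts collect into [K * K'], which is
    symmetric by [perV]; intersecting with [U] recovers the [U]-parts. *)
Let commuteF (H K H' K' : {group gT}) :
    H \subset U -> K \subset V -> H' \subset U -> K' \subset V ->
  (F H K * F H' K' == F H' K' * F H K) = (H * H' == H' * H).
Proof.
move=> sH sK sH' sK'; rewrite !FE //.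
have swap (A B A' B' : {group gT}) : A' \subset U -> B \subset V ->
    A * B * (A' * B') = A * A' * (B * B').
  move=> sA' sB; rewrite -!mulgA [B * (A' * _)]mulgA [A' * (B * _)]mulgA.
  by rewrite (centC (subset_trans sB (subset_trans cUV (centS sA')))).
rewrite (swap H K H' K') // (swap H' K' H K) // (permutableP _ perV K K' sK sK').
apply/eqP/eqP=> [eqHK | -> //].
have := congr1 (fun A => A :&: U) eqHK.
by rewrite !mulI_l ?mul_subG // -[1]mulg1 mem_mulg.
Qed.

(** If [V] has [v] cyclic subgroups, passing from [U] to [T] multiplies the cyclic subgroups by [v]
    and the permuting pairs by [v^2]. *)
Lemma csd_coprime_dprod : csd T = csd U.
Proof.
have subC (W H : {group gT}) : H \in cyclic_subgroups W -> H \subset W.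
  by rewrite mem_cyclic_subgroups => /andP[].
have cardC : #|cyclic_subgroups T| = (#|cyclic_subgroups U| * #|cyclic_subgroups V|)%N.
  rewrite cyclicF card_in_imset ?cardsX // => -[H K] [H' K'].
  move=> /setXP[/subC sH /subC sK] /setXP[/subC sH' /subC sK'] /=.
  by case/F_inj=> // -> ->.
pose cV := cyclic_subgroups V.
pose E (P : ({group gT} * {group gT}) * ({group gT} * {group gT})) :=
  (F P.1.1 P.2.1, F P.1.2 P.2.2).
have defP : commuting_cyclic_pairs T = E @: setX (commuting_cyclic_pairs U) (setX cV cV).
  apply/setP=> -[X Y]; apply/idP/imsetP=> [|[[[H H'] [K K']] /setXP[]]].
    rewrite inE /= => /and3P[]; rewrite cyclicF.
    case/imsetP=> -[H K] /setXP[UH VK] ->; case/imsetP=> -[H' K'] /setXP[UH' VK'] -> /=.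
    rewrite commuteF ?subC // => cHH'; exists ((H, H'), (K, K')) => //.
    by rewrite !in_setX inE /= UH UH' cHH' VK.
  rewrite inE /= => /and3P[UH UH' cHH'] /setXP[VK VK'] [-> ->].
  rewrite inE /= commuteF ?subC // cHH' andbT cyclicF.
  apply/andP; split; apply/imsetP.
    by exists (H, K); rewrite // in_setX UH.
  by exists (H', K'); rewrite // in_setX UH'.
have cardP : #|commuting_cyclic_pairs T| = (#|commuting_cyclic_pairs U| * #|cV| ^ 2)%N.
  rewrite defP card_in_imset ?cardsX ?mulnn // => -[[H H'] [K K']] [[L L'] [M M']].
  move=> /setXP[+ /setXP[/subC sK /subC sK']] /setXP[+ /setXP[/subC sM /subC sM']].
  rewrite !inE -!mem_cyclic_subgroups /=.
  move=> /and3P[/subC sH /subC sH' _] /and3P[/subC sL /subC sL' _].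
  rewrite /E /= => eqE; have [-> ->] := F_inj sH sK sL sM (congr1 fst eqE).
  by have [-> ->] := F_inj sH' sK' sL' sM' (congr1 snd eqE).
rewrite /csd cardP cardC natrM natrX natrM exprMn -mulf_div divff ?mulr1 //.
by rewrite expf_neq0 // pnatr_eq0 -lt0n cyclic_subgroups_gt0.
Qed.

End CoprimeProduct.

Lemma permutable_morphim (aT rT : finGroupType) (D : {group aT})
    (f : {morphism D >-> rT}) (G : {group aT}) :
  G \subset D -> permutable G -> permutable (f @* G).
Proof.
move=> sGD /permutableP perG; apply/permutableP=> H K sH sK.
have lift (L : {group rT}) : L \subset f @* G ->
    exists2 M : {group aT}, M \subset G & f @* M = L.
  by move=> sL; exists (G :&: f @*^-1 L)%G; rewrite ?subsetIl ?morphim_setIpre ?(setIidPr sL).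
have [[H1 sH1 <-] [K1 sK1 <-]] := (lift H sH, lift K sK).
by rewrite /commute -morphimMl ?(subset_trans sH1) // -morphimMl ?(subset_trans sK1) // perG.
Qed.

(** In any section [A / B] of [T] the [pi']-core is an image of a subgroup of [V], hence permutable
    and irrelevant to [csd]. The [pi]-core is isomorphic to a section of [U]. *)
Lemma csd_star_coprime_dprod (gT : finGroupType) (pi : nat_pred) (T U V : {group gT}) :
    nilpotent T -> U \x V = T -> pi.-group U -> pi^'.-group V -> permutable V ->
  csd_star T = csd_star U.
Proof.
move=> nilT defT piU pi'V perV; have [nsU nsV] := dprod_normal2 defT.
have mulUV : U * V = T by case/dprodP: defT.
have [hallU hallV] := coprime_mulpG_Hall mulUV piU pi'V.
apply/eqP; rewrite eq_le csd_starS ?normal_sub //=.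
have [A [B [sAT nsBA ->]]] := csd_star_ex T; have nBA := normal_norm nsBA.
have nilA := nilpotentS sAT nilT; have nilAB := quotient_nil B nilA.
have defO rho : 'O_rho(A / B) = 'O_rho(A) / B.
  apply/esym/(nilpotent_Hall_pcore (G := (A / B)%G) (H := ('O_rho(A) / B)%G)) => //.
  apply: quotient_pHall (nilpotent_pcore_Hall rho nilA).
  exact: subset_trans (pcore_sub _ _) nBA.
have sOU : 'O_pi(A) \subset U.
  by rewrite (sub_normal_Hall hallU) ?pcore_pgroup // (subset_trans (pcore_sub _ _)).
have sOV : 'O_pi^'(A) \subset V.
  by rewrite (sub_normal_Hall hallV) ?pcore_pgroup // (subset_trans (pcore_sub _ _)).
have perO : permutable 'O_pi^'(A / B).
  rewrite defO; apply: permutable_morphim (permutableS sOV perV).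
  exact: subset_trans (pcore_sub _ _) nBA.
have dprodO := nilpotent_pcoreC pi nilAB.
rewrite (csd_coprime_dprod (T := (A / B)%G) dprodO (pcore_pgroup _ _) (pcore_pgroup _ _) perO).
rewrite /= defO -(isog_csd (second_isog (subset_trans (pcore_sub pi A) nBA))).
apply: (csd_star_le (A := 'O_pi(A)%G) (B := (B :&: 'O_pi(A))%G)) => //.
by rewrite /= setIC (normalGI (pcore_sub pi A) nsBA).
Qed.

(** * The Iwasawa criterion and the equality case *)

Lemma isog_setX_dprod (gT : finGroupType) (G H K : {group gT}) :
  H \x K = G -> G \isog setX H K.
Proof. by case/mulgmP/misomP=> fM /isom_isog isoX; rewrite isog_sym isoX. Qed.

Theorem theorem4p5 (gT : finGroupType) (G : {group gT}) :
  ((41%:R / 49%:R < csd_star G)%R -> Iwasawa G) /\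
  (csd_star G = (41%:R / 49%:R)%R <->
   exists (gT1 gT2 : finGroupType) (G1 : {group gT1}) (G2 : {group gT2}),
     [/\ (G \isog setX G1 G2)%g,
         (2%N.-group G1)%g,
         csd_star G1 = (41%:R / 49%:R)%R,
         Iwasawa G2
       & odd #|G2|]).
Proof.
have lt_nonnil := csd_star_nonnilpotent; have le_nonperm := csd_star_nonpermutable.
(* From here only the two bounds matter, so the constant becomes a parameter [c]. *)
move: (41%:R / 49%:R)%R lt_nonnil le_nonperm => c lt_nonnil le_nonperm.
have nil_of : (c <= csd_star G)%R -> nilpotent G.
  by move=> le_c; apply: contraLR le_c => /lt_nonnil; rewrite -ltNge.
split=> [lt_c | ].
  have nilG := nil_of (ltW lt_c); split=> //; apply: permutable_modular.
  by apply: contraLR lt_c => /(le_nonperm _ _ nilG)[le_c _]; rewrite -leNgt.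
split=> [eq_c | [gT1 [gT2 [G1 [G2 [isoG pG1 eq_c [nilG2 modG2] oddG2]]]]]].
  have nilG : nilpotent G by apply: nil_of; rewrite eq_c.
  pose U := 'O_2(G)%G; pose V := 'O_2^'(G)%G.
  have defG : U \x V = G := nilpotent_pcoreC 2 nilG.
  have oddV : odd #|V| by rewrite odd_2'nat; apply: pcore_pgroup.
  have nilV : nilpotent V := nilpotentS (pcore_sub _ _) nilG.
  (* Otherwise the strict bound for odd order gives [csd_star V < c], while
     [csd_star V >= csd_star G = c]. *)
  have perV : permutable V.
    apply: contraT => /(le_nonperm _ _ nilV)[_ /(_ oddV)].
    have := csd_starS (pcore_sub 2^' G); rewrite eq_c => le_c lt_c.
    by case/negP: (lt_geF lt_c); apply: le_c.
  exists gT, gT, U, V; split=> //.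
  - exact: isog_setX_dprod.
  - exact: pcore_pgroup.
  - rewrite -eq_c; apply/esym.
    exact: csd_star_coprime_dprod nilG defG (pcore_pgroup _ _) (pcore_pgroup _ _) perV.
  by split; last exact: permutable_modular.
have defX := setX_dprod G1 G2.
have isoU := isog_setX1 gT2 G1; have isoV := isog_set1X gT1 G2.
have nilX : nilpotent (setX G1 G2).
  by rewrite (dprod_nil defX) -(isog_nil isoU) -(isog_nil isoV) nilG2 (pgroup_nil pG1).
have perV : permutable (setX 1 G2 : {set gT1 * gT2}).
  have [f _ <-] := isogP isoV.
  exact: permutable_morphim (modular_permutable nilG2 modG2).
(* The isomorphic copies [setX G1 1] and [setX 1 G2] make the external product an internal one. *)
rewrite (isog_csd_star isoG) -eq_c (isog_csd_star isoU).
apply: (csd_star_coprime_dprod (pi := 2) nilX defX) => //.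
  by rewrite -(isog_pgroup _ isoU).
by rewrite -(isog_pgroup _ isoV) /pgroup -odd_2'nat.
Qed.
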